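(* Let $H\in\mathbb{R}^{N\times M}$ have positive entries, let $y\in\mathbb{R}^N$, $y\neq0$, be data with nonnegative components, and fix $\tau>0$ and an initialization $x^{(0)}$ with positive components. Consider Pearson's cumulative test: stop EM at the first iteration $k$ such that $$\sum_{i=1}^N \frac{\big((Hx^{(k)})_i-y_i\big)^2}{(Hx^{(k)})_i}\le \tau N ,$$ where $x^{(k)}$ is the EM iteration for the data $y$. Then EM supplied with Pearson's cumulative test is a well-defined regularization method for the constrained maximum likelihood problem with Poisson noise if and only if $y\in H(\mathcal{C})$.
   Context: Products and quotients of vectors are taken componentwise; $1$ is the vector of ones; $\mathcal{C}=\{x\in\mathbb{R}^M : x_j\ge 0\ \forall j\}$ and $H(\mathcal{C})=\{Hx : x\in\mathcal{C}\}$. In the Poisson model the data are independent Poisson variables with means $(Hx)_i$, and the constrained maximum likelihood problem is to minimize over $x\in\mathcal{C}$ the Kullback–Leibler divergence $D_{KL}(y,x)=\sum_{i=1}^N \big( y_i\log\frac{y_i}{(Hx)_i}+(Hx)_i-y_i\big)$, with the conventions $0\log(0/t)=0$ for $t\ge0$ and $s\log(s/0)=+\infty$ for $s>0$. EM is the iteration $x^{(k+1)}=\dfrac{x^{(k)}}{H^T1}\,H^T\dfrac{y}{Hx^{(k)}}$. It is a known fact, taken for granted, that EM converges to a minimizer of $D_{KL}(y,\cdot)$ over $\mathcal{C}$. Definition (regularization method). An iterative method with a stopping rule is a regularization method if (1) the iterates $y\mapsto x^{(k)}$ are defined for all data $y$ of the form $Hx$, $x\in\mathcal{C}\setminus\{0\}$;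 and (2) the stopping rule selects an iteration index such that the stopped iterate tends (asymptotically) to a solution $\hat x$ of the constrained maximum likelihood problem as the coefficient of variation $\delta$ (standard deviation divided by mean) tends to zero. In the Poisson case $\delta\to0$ means that the data tend to infinity, i.e. $y$ is replaced by $y_L=Ly$ with $L\to\infty$. Denote by $x_L^{(k)}$ the EM iterates for the data $y_L$ with the same initialization $x^{(0)}$. Then (2) reads: for every $L>0$ some iteration satisfies the stopping inequality written with $y_L$ and $x_L^{(k)}$ in place of $y$ and $x^{(k)}$, and, writing $k(L)$ for the first such iteration, $\lim_{L\to\infty}\frac1L x_L^{(k(L))}=\hat x$ for some minimizer $\hat x$ of $D_{KL}(y,\cdot)$ over $\mathcal{C}$. *)

(* Defs.v *)
From HB Require Import structures.
From mathcomp Require Import all_boot all_order all_algebra.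
From mathcomp Require Import all_classical all_reals all_analysis.
Set Implicit Arguments.
Unset Strict Implicit.
Unset Printing Implicit Defensive.
Import Order.TTheory GRing.Theory Num.Theory.
Import numFieldNormedType.Exports.
Local Open Scope classical_set_scope.
Local Open Scope ring_scope.

Section Vectors.
Variable R : realType.

Definition ones (n : nat) : 'cV[R]_n := const_mx 1.

Definition vmul (n : nat) (u v : 'cV[R]_n) : 'cV[R]_n := map2_mx *%R u v.

(* Meaningful only when [nonvanishing v]; elsewhere division by 0 yields 0. *)
Definition vdiv (n : nat) (u v : 'cV[R]_n) : 'cV[R]_n :=
  map2_mx (fun a b => a / b) u v.

Definition nonvanishing (n : nat) (v : 'cV[R]_n) : Prop :=
  forall i, v i 0 != 0.

Definition cone (n : nat) : set 'cV[R]_n := [set x | forall j, 0 <= x j 0].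

End Vectors.

Section MaximumLikelihood.
Variables (R : realType) (N M : nat) (H : 'M[R]_(N, M)).

(* s log (s / t) for s, t >= 0, with 0 log (0 / t) = 0 and
   s log (s / 0) = +oo for s > 0. *)
Definition log_term (s t : R) : \bar R :=
  if s == 0 then 0%E
  else if t == 0 then +oo%E
  else (s * ln (s / t))%:E.

Definition KL (y : 'cV[R]_N) (x : 'cV[R]_M) : \bar R :=
  (\sum_(i < N) (log_term (y i 0)%R ((H *m x) i 0)%R
                 + ((H *m x) i 0 - y i 0)%R%:E))%E.

Definition ml_solution (y : 'cV[R]_N) (x : 'cV[R]_M) : Prop :=
  @cone R M x /\ forall z, @cone R M z -> (KL y x <= KL y z)%E.

End MaximumLikelihood.

Section RegularizationMethods.
Variables (R : realType) (N M : nat).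

(* The iterates are total functions; [iterate_defined y k] says that computing
   the k-th iterate for the data y involves no division by 0. *)
Record stopped_method := StoppedMethod {
  iterate : 'cV[R]_N -> nat -> 'cV[R]_M;
  iterate_defined : 'cV[R]_N -> nat -> Prop;
  stopping_rule : 'cV[R]_N -> 'cV[R]_M -> Prop
}.

Definition stops_at (A : stopped_method) (y : 'cV[R]_N) (k : nat) : Prop :=
  iterate_defined A y k /\ stopping_rule A y (iterate A y k).

Definition first_stop (A : stopped_method) (y : 'cV[R]_N) (k : nat) : Prop :=
  stops_at A y k /\ forall l, (l < k)%N -> ~ stops_at A y l.

Definition regularization_method (H : 'M[R]_(N, M)) (y : 'cV[R]_N)
    (A : stopped_method) : Prop :=
  (forall x : 'cV[R]_M, @cone R M x -> x != 0 ->
     forall k, iterate_defined A (H *m x) k) /\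
  (exists k : R -> nat,
     (forall L : R, 0 < L -> first_stop A (L *: y) (k L)) /\
     exists xhat : 'cV[R]_M, ml_solution H y xhat /\
       (L^-1 *: iterate A (L *: y) (k L)) @[L --> +oo%R] --> xhat).

End RegularizationMethods.

Section EM.
Variables (R : realType) (N M : nat) (H : 'M[R]_(N, M)).

Definition em_step (y : 'cV[R]_N) (x : 'cV[R]_M) : 'cV[R]_M :=
  vmul (vdiv x (H^T *m ones R N)) (H^T *m vdiv y (H *m x)).

Definition em (x0 : 'cV[R]_M) (y : 'cV[R]_N) (k : nat) : 'cV[R]_M :=
  iter k (em_step y) x0.

Definition em_defined (x0 : 'cV[R]_M) (y : 'cV[R]_N) (k : nat) : Prop :=
  forall l, (l < k)%N ->
    nonvanishing (H^T *m ones R N) /\ nonvanishing (H *m em x0 y l).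

Definition pearson (y : 'cV[R]_N) (x : 'cV[R]_M) : R :=
  \sum_(i < N) ((H *m x) i 0 - y i 0) ^+ 2 / (H *m x) i 0.

Definition pearson_test (tau : R) (y : 'cV[R]_N) (x : 'cV[R]_M) : Prop :=
  nonvanishing (H *m x) /\ pearson y x <= tau * N%:R.

Definition em_pearson (x0 : 'cV[R]_M) (tau : R) : stopped_method R N M :=
  StoppedMethod (em x0) (em_defined x0) (pearson_test tau).

End EM.

(* Main.v *)
Require Import Defs.
From HB Require Import structures.
From mathcomp Require Import all_boot all_order all_algebra.
From mathcomp Require Import all_classical all_reals all_analysis.
From mathcomp Require Import lra ring.
Import Order.TTheory GRing.Theory Num.Theory.
Import numFieldNormedType.Exports.
Local Open Scope classical_set_scope.
Local Open Scope ring_scope.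

(* After the first step EM is homogeneous in the data, x_L^(k) = L x^(k), so the
   test for the data L y reads L P(x^(k)) <= tau N, where P is Pearson's
   statistic for y. If the stopped and rescaled iterates converge to xhat, then
   P is at most tau N / L along them, which forces H xhat = y.

   Conversely let H z = y with z in the cone. Put kl a b = a ln (a / b) + b - a
   and let s be the vector of column sums of H. By Jensen's inequality
   D(z, x) = sum_j s_j kl (z_j) (x_j) drops by at least KL(y, H x) in each EM
   step, so KL(y, H x^(k)) -> 0 and H x^(k) -> y. The iterates are bounded; at a
   cluster point xhat we have H xhat = y, so D(xhat, x^(k)) is nonincreasing and
   has 0 as a cluster value, whence x^(k) -> xhat and P(x^(k)) -> 0. As L grows,
   either the stopping index tends to infinity or EM has hit an exact solution,
   which is a fixed point. *)

(** * Scalar bounds on the divergence integrand, and Jensen's inequality *)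

Section ScalarDivergence.
Context {R : realType}.
Implicit Types a b t : R.

Lemma ln_le_subr1 t : 0 < t -> ln t <= t - 1.
Proof.
by move=> t0; have := @le_ln1Dx R (t - 1); rewrite [1 + _]addrC subrK; apply; lra.
Qed.

(* For [a = 0] the junk value [ln 0 = 0] is harmless: [kl 0 b = b]. *)
Definition kl a b := a * ln (a / b) + b - a.

Lemma kl0 b : kl 0 b = b.
Proof. by rewrite /kl mul0r add0r subr0. Qed.

Lemma kl_le a b : 0 <= a -> 0 < b -> kl a b <= (a - b) ^+ 2 / b.
Proof.
rewrite le_eqVlt => /predU1P[<- b0|a0 b0].
  by rewrite kl0 sub0r sqrrN expr2 mulfK ?gt_eqF.
have /ln_le_subr1 : 0 < a / b by rewrite divr_gt0.
move/(ler_wpM2l (ltW a0)); rewrite /kl.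
have -> : a * (a / b - 1) = (a - b) ^+ 2 / b - b + a by field; rewrite gt_eqF.
by move=> h; lra.
Qed.

(** With a = s^2 and b = t^2 the logarithm becomes -2 ln (t / s), and [ln_le_subr1] at t / s leaves
    exactly s^2 + t^2 - 2 s t. *)
Lemma kl_ge_hellinger a b : 0 <= a -> 0 < b ->
  (Num.sqrt a - Num.sqrt b) ^+ 2 <= kl a b.
Proof.
rewrite le_eqVlt => /predU1P[<- b0|a0 b0].
  by rewrite kl0 sqrtr0 sub0r sqrrN sqr_sqrtr // ltW.
have {a0} [s s0 ->] : exists2 s, 0 < s & a = s ^+ 2.
  by exists (Num.sqrt a); rewrite ?sqrtr_gt0// sqr_sqrtr ?ltW.
have {b0} [t t0 ->] : exists2 t, 0 < t & b = t ^+ 2.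
  by exists (Num.sqrt b); rewrite ?sqrtr_gt0// sqr_sqrtr ?ltW.
rewrite !sqrtr_sqr !gtr0_norm// /kl -expr_div_n lnXn ?divr_gt0//.
rewrite -[s / t]invf_div lnV ?posrE ?divr_gt0//.
have /ln_le_subr1 : 0 < t / s by rewrite divr_gt0.
move: (ln _) => w hw.
have h : s ^+ 2 * w <= s * t - s ^+ 2.
  apply: (le_trans (ler_wpM2l (sqr_ge0 s) hw)).
  have -> : s ^+ 2 * (t / s - 1) = s * t - s ^+ 2 by field; rewrite gt_eqF.
  by [].
by rewrite -mulr_natl; nra.
Qed.

Lemma kl_ge0 a b : 0 <= a -> 0 < b -> 0 <= kl a b.
Proof. by move=> a0 b0; apply: le_trans (kl_ge_hellinger _ _ a0 b0); exact: sqr_ge0. Qed.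

(** A Pinsker-type bound: with a = s^2 and b = t^2, (a - b)^2 = (s - t)^2 (s + t)^2, where (s + t)^2
    <= 2 (a + b). *)
Lemma sqr_sub_le_kl a b : 0 <= a -> 0 < b -> (a - b) ^+ 2 <= 2 * (a + b) * kl a b.
Proof.
move=> a0 b0; apply: (@le_trans _ _ (2 * (a + b) * (Num.sqrt a - Num.sqrt b) ^+ 2)).
  have [s ->] : exists s, a = s ^+ 2 by exists (Num.sqrt a); rewrite sqr_sqrtr.
  have [t ->] : exists t, b = t ^+ 2.
    by exists (Num.sqrt b); rewrite sqr_sqrtr// ltW.
  rewrite !sqrtr_sqr -(real_normK (num_real s)) -(real_normK (num_real t)).
  have := normr_ge0 s; have := normr_ge0 t.
  move: `|s| `|t| => {}s {}t t0 s0; rewrite subr_sqr exprMn mulrC.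
  by rewrite ler_wpM2r ?sqr_ge0//; have := sqr_ge0 (s - t); nra.
by rewrite ler_wpM2l ?kl_ge_hellinger// mulr_ge0// addr_ge0// ltW.
Qed.

(** Each ln (z i) lies below the tangent of ln at the weighted mean [m], and the linear corrections
    sum to 0. The weights are left unnormalised because they will be a column of [H], of total
    [sensitivity j]. *)
Lemma ln_jensen (I : finType) (w z : I -> R) : (forall i, 0 < w i) ->
  (forall i, 0 < z i) ->
  \sum_i w i * ln (z i) <=
  (\sum_i w i) * ln ((\sum_i w i)^-1 * \sum_i w i * z i).
Proof.
move=> w0 z0; have [i0 _|I0] := pickP (mem I); last first.
  by rewrite !big_pred0 ?mul0r.
set W := \sum_i w i; set m := W^-1 * _.
have W0 : 0 < W by rewrite (lt_le_trans (w0 i0))// /W (bigD1 i0)//= lerDl sumr_ge0// => i _; exact: ltW.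
have m0 : 0 < m.
  rewrite mulr_gt0 ?invr_gt0// (lt_le_trans (mulr_gt0 (w0 i0) (z0 i0)))//.
  by rewrite (bigD1 i0)//= lerDl sumr_ge0// => i _; rewrite ltW// mulr_gt0.
have h i : w i * ln (z i) <= w i * ln m + (m^-1 * (w i * z i) - w i).
  have := ln_le_subr1 _ (divr_gt0 (z0 i) m0).
  rewrite ln_div ?posrE// -(ler_pM2l (w0 i)) !mulrBr mulr1 => h.
  by rewrite -lerBlDl (le_trans h)// mulrA [m^-1 * _]mulrC.
rewrite (le_trans (ler_sum _ (fun i _ => h i)))// big_split/= -mulr_suml -/W.
rewrite gerDl big_split/= sumrN -mulr_sumr -/W.
have -> : \sum_i w i * z i = W * m by rewrite /m mulVKf ?gt_eqF.
by rewrite mulrCA mulVf ?gt_eqF// mulr1 subrr.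
Qed.

End ScalarDivergence.

(** * The EM step: positivity, scaling, conservation of mass, descent *)

Section EMIteration.
Context {R : realType} {N M : nat} (H : 'M[R]_(N, M)).
Hypothesis H_pos : forall i j, 0 < H i j.
Implicit Types (x z : 'cV[R]_M) (y : 'cV[R]_N).

Definition positive n (v : 'cV[R]_n) := forall i, 0 < v i 0.

Lemma mulmx_cvE x i : (H *m x) i 0 = \sum_j H i j * x j 0.
Proof. by rewrite mxE. Qed.

Lemma cv_neq0P n (v : 'cV[R]_n) : v != 0 -> exists i, v i 0 != 0.
Proof.
move=> v0; apply/existsP; apply: contraNT v0; rewrite negb_exists => /forallP v0.
by apply/eqP/matrixP => i j; rewrite ord1 mxE; apply/eqP; rewrite -[_ == _]negbK v0.
Qed.

Lemma mulmx_ge0 x : cone x -> forall i, 0 <= (H *m x) i 0.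
Proof. by move=> x0 i; rewrite mulmx_cvE sumr_ge0// => j _; rewrite mulr_ge0// ltW. Qed.

Lemma mulmx_positive x : cone x -> x != 0 -> positive _ (H *m x).
Proof.
move=> x0 /cv_neq0P[j xj] i; rewrite mulmx_cvE.
have h k : 0 <= H i k * x k 0 by rewrite mulr_ge0// ltW.
rewrite (bigD1 j)//= ltr_wpDr ?sumr_ge0// mulr_gt0//.
by rewrite lt_def xj x0.
Qed.

Definition sensitivity (j : 'I_M) : R := \sum_i H i j.

Lemma trmx_onesE j : (H^T *m ones R N) j 0 = sensitivity j.
Proof. by rewrite mxE; apply: eq_bigr => i _; rewrite !mxE mulr1. Qed.

Lemma em_stepE y x j : em_step H y x j 0 =
  x j 0 * ((sensitivity j)^-1 * \sum_i H i j * (y i 0 / (H *m x) i 0)).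
Proof.
rewrite -trmx_onesE !mxE -mulrA; congr (_ * (_ * _)).
by apply: eq_bigr => i _; rewrite !mxE.
Qed.

Lemma positive_cone n (v : 'cV[R]_n) : positive _ v -> cone v.
Proof. by move=> v0 j; rewrite ltW. Qed.

Lemma positive_neq0 n (v : 'cV[R]_n) : 'I_n -> positive _ v -> v != 0.
Proof.
by move=> i v0; apply: contraTneq (v0 i) => ->; rewrite mxE ltxx.
Qed.

Lemma sensitivity_gt0 (i : 'I_N) j : 0 < sensitivity j.
Proof.
rewrite /sensitivity (bigD1 i)//= ltr_wpDr// sumr_ge0// => k _; exact: ltW.
Qed.

Lemma em_step_positive y x : 'I_N -> positive _ y -> positive _ x ->
  positive _ (em_step H y x).
Proof.
move=> i0 y0 x0 j; rewrite em_stepE !mulr_gt0//.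
  by rewrite invr_gt0 sensitivity_gt0.
have hx : positive _ (H *m x).
  by apply: mulmx_positive; [exact: positive_cone|exact: positive_neq0].
have h i : 0 < H i j * (y i 0 / (H *m x) i 0) by rewrite mulr_gt0// divr_gt0.
by rewrite (bigD1 i0)//= ltr_wpDr// sumr_ge0// => i _; exact: ltW.
Qed.

Lemma em_positive x0 y k : 'I_N -> positive _ y -> positive _ x0 ->
  positive _ (em H x0 y k).
Proof. by move=> i0 y0 x00; elim: k => //= k IH; exact: em_step_positive. Qed.

Lemma em_stepZ L y x : L != 0 -> em_step H (L *: y) (L *: x) = L *: em_step H y x.
Proof.
move=> L0; apply/matrixP => j k; rewrite ord1 [RHS]mxE !em_stepE !mxE -mulrA.
congr (_ * (_ * (_ * _))); apply: eq_bigr => i _.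
by rewrite -scalemxAr !mxE -mulf_div divff// mul1r.
Qed.

(** Serves the first step, where the data are rescaled but the initialization is not. *)
Lemma em_step_scale_data L y x : em_step H (L *: y) x = L *: em_step H y x.
Proof.
apply/matrixP => j k; rewrite ord1 [RHS]mxE !em_stepE [RHS]mulrCA; congr (_ * _).
rewrite [RHS]mulrCA; congr (_ * _); rewrite mulr_sumr.
by apply: eq_bigr => i _; rewrite mxE -mulrA [RHS]mulrCA.
Qed.

(* Off by one on purpose: the 0-th iterate is [x0] whatever the data. *)
Lemma em_scale_data L x0 y k : L != 0 ->
  em H x0 (L *: y) k.+1 = L *: em H x0 y k.+1.
Proof.
move=> L0; elim: k => [|k IH]; first exact: em_step_scale_data.
by rewrite /em iterS -/(em _ _ _ _) IH em_stepZ.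
Qed.

Lemma pearsonZ L y x : 0 < L -> pearson H (L *: y) (L *: x) = L * pearson H y x.
Proof.
move=> L0; rewrite /pearson mulr_sumr; apply: eq_bigr => i _.
rewrite -scalemxAr !mxE -mulrBr exprMn.
by rewrite -mulf_div [L ^+ 2]expr2 mulfK ?gt_eqF.
Qed.

Lemma em_step_fixed y x : 'I_N -> positive _ y -> H *m x = y ->
  em_step H y x = x.
Proof.
move=> i0 y0 Hx; apply/matrixP => j k; rewrite ord1 em_stepE Hx.
rewrite [X in _^-1 * X](_ : _ = sensitivity j) ?mulVf ?mulr1//.
  by rewrite gt_eqF ?sensitivity_gt0.
by apply: eq_bigr => i _; rewrite divff ?mulr1// gt_eqF.
Qed.

Lemma sum_sensitivity x : \sum_j sensitivity j * x j 0 = \sum_i (H *m x) i 0.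
Proof.
under [RHS]eq_bigr do rewrite mulmx_cvE; rewrite exchange_big/=.
by apply: eq_bigr => j _; rewrite mulr_suml.
Qed.

(** Conservation of mass: after exchanging the sums, the weights attached to y_i add up to (H x)_i /
    (H x)_i. This bounds all iterates after the initial one. *)
Lemma sum_sensitivity_em_step y x : 'I_N -> 'I_M -> positive _ x ->
  \sum_j sensitivity j * em_step H y x j 0 = \sum_i y i 0.
Proof.
move=> i0 j0 x0.
transitivity (\sum_j \sum_i H i j * x j 0 * (y i 0 / (H *m x) i 0)).
  apply: eq_bigr => j _; rewrite em_stepE mulrCA mulVKf ?gt_eqF ?sensitivity_gt0//.
  by rewrite mulr_sumr; apply: eq_bigr => i _; rewrite mulrCA mulrA.
rewrite exchange_big/=; apply: eq_bigr => i _; rewrite -mulr_suml -mulmx_cvE.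
rewrite mulrCA divff ?mulr1// gt_eqF// mulmx_positive//; first exact: positive_cone.
exact: positive_neq0.
Qed.

Definition data_gap y x := \sum_i kl (y i 0) ((H *m x) i 0).
Definition cone_gap z x := \sum_j sensitivity j * kl (z j 0) (x j 0).

(* The decrease is at least a sum over j of z_j times a logarithm of a mean with
   weights H i j, to which [ln_jensen] applies. *)
Lemma em_step_descent y x z : 'I_N -> 'I_M -> positive _ y -> positive _ x ->
  cone z -> H *m z = y ->
  cone_gap z (em_step H y x) + data_gap y x <= cone_gap z x.
Proof.
move=> i0 j0 y0 x0 z0 Hz.
have x'0 := em_step_positive y x i0 y0 x0.
have hx0 : positive _ (H *m x).
  by apply: mulmx_positive; [exact: positive_cone|exact: positive_neq0].
have klB a b c : 0 <= a -> 0 < b -> 0 < c -> kl a b - kl a c = a * ln (c / b) + b - c.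
  rewrite /kl le_eqVlt => /predU1P[<-|a0] b0 c0; first by rewrite !mul0r; ring.
  by rewrite !ln_div ?posrE//; ring.
rewrite addrC -lerBrDr /cone_gap -sumrB.
under [leRHS]eq_bigr do rewrite -mulrBr klB// -addrA mulrDr mulrBr.
(* By the two mass identities the linear parts of the cone gaps differ by the sum of H x minus the
   sum of y. This is also the linear part of [data_gap], so only logarithms remain. *)
rewrite big_split/= sumrB sum_sensitivity sum_sensitivity_em_step//.
rewrite /data_gap /kl sumrB big_split/= -addrA lerD2r.
have -> : \sum_i y i 0 * ln (y i 0 / (H *m x) i 0) =
    \sum_j z j 0 * \sum_i H i j * ln (y i 0 / (H *m x) i 0).
  under [RHS]eq_bigr do rewrite mulr_sumr.
  rewrite exchange_big/=; apply: eq_bigr => i _.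
  rewrite -{1}Hz mulmx_cvE mulr_suml; apply: eq_bigr => j _.
  by rewrite mulrCA mulrA.
apply: ler_sum => j _; rewrite mulrCA ler_wpM2l// em_stepE.
rewrite [x j 0 * _]mulrC mulfK ?gt_eqF//.
by apply: ln_jensen => // i; rewrite divr_gt0.
Qed.

End EMIteration.

(** * Limits of finite sums, of matrix entries and of [kl] *)

Section Convergence.
Context {R : realType} {T : Type} (F : set_system T) {FF : Filter F}.

Lemma cvg_big_sum (I : finType) (f : I -> T -> R) (l : I -> R) :
  (forall i, f i t @[t --> F] --> l i) ->
  \sum_i f i t @[t --> F] --> \sum_i l i.
Proof.
move=> fl; elim: (index_enum I) => [|i r IH].
  rewrite big_nil; under eq_fun do rewrite big_nil; exact: cvg_cst.
by rewrite big_cons; under eq_fun do rewrite big_cons; exact: cvgD.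
Qed.

Lemma cvg_entries m n (f : T -> 'M[R]_(m, n)) (l : 'M[R]_(m, n)) :
  (forall i j, f t i j @[t --> F] --> l i j) -> f t @[t --> F] --> l.
Proof.
move=> fl P [Q nQ QP]; apply: (filterS (fun t => QP (f t))).
by apply: filter_forall => i; apply: filter_forall => j; exact: fl.
Qed.

Lemma cvg_entry m n (f : T -> 'M[R]_(m, n)) (l : 'M[R]_(m, n)) i j :
  f t @[t --> F] --> l -> f t i j @[t --> F] --> l i j.
Proof. by move=> fl; exact: (cvg_comp _ _ fl (@coord_continuous R m n i j l)). Qed.

(** Squeezed between 0 and the bound [kl_le]. The case a = 0 is separate because the denominator of
    that bound then tends to 0. *)
Lemma cvg_kl0 (a : R) (b : T -> R) : 0 <= a -> (\forall t \near F, 0 < b t) ->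
  b t @[t --> F] --> a -> kl a (b t) @[t --> F] --> 0.
Proof.
rewrite le_eqVlt => /predU1P[<- _|a0 b0] ba.
  by under eq_fun do rewrite kl0.
apply: (@squeeze_cvgr _ _ _ _ (cst 0) (fun t => (a - b t) ^+ 2 / b t)).
- near=> t; have bt : 0 < b t by near: t.
  by rewrite kl_ge0 ?kl_le// ltW.
- exact: cvg_cst.
- rewrite -(mul0r a^-1); apply: cvgM; last by apply: cvgV => //; rewrite gt_eqF.
  rewrite -[X in _ --> X](expr0n _ 2) -(subrr a) expr2.
  by under eq_fun do rewrite expr2; apply: cvgM; apply: cvgB => //; exact: cvg_cst.
Unshelve. all: by end_near. Qed.

Lemma cvg_of_kl0 (a B : R) (b : T -> R) : 0 <= a ->
  (\forall t \near F, 0 < b t <= B) ->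
  kl a (b t) @[t --> F] --> 0 -> b t @[t --> F] --> a.
Proof.
move=> a0 bB kl0; apply/subr_cvg0; apply/norm_cvg0P.
have h : Num.sqrt (2 * (a + B) * kl a (b t)) @[t --> F] --> 0.
  rewrite -[X in _ --> X]sqrtr0 -(mulr0 (2 * (a + B))).
  apply: continuous_cvg; first exact: sqrt_continuous.
  by apply: cvgM => //; exact: cvg_cst.
apply: squeeze_cvgr _ (cvg_cst 0) h.
near=> t; have /andP[bt btB] : 0 < b t <= B by near: t.
rewrite normr_ge0/= distrC -sqrtr_sqr ler_wsqrtr// (le_trans (sqr_sub_le_kl _ _ a0 bt))//.
by rewrite ler_wpM2r ?kl_ge0// ler_wpM2l// lerD2l.
Unshelve. all: by end_near. Qed.

End Convergence.

(** * Convergence of EM when the data are attained on the cone *)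

Section EMConvergence.
Context {R : realType} {N M : nat} (H : 'M[R]_(N, M)).
Hypothesis H_pos : forall i j, 0 < H i j.
Implicit Types (x z : 'cV[R]_M) (y : 'cV[R]_N).

Lemma cvg_mulmx_entry {T} (F : set_system T) {FF : Filter F} (f : T -> 'cV[R]_M) x i :
  (forall j, f t j 0 @[t --> F] --> x j 0) ->
  (H *m f t) i 0 @[t --> F] --> (H *m x) i 0.
Proof.
move=> fx; under eq_fun do rewrite mulmx_cvE; rewrite mulmx_cvE.
by apply: cvg_big_sum => j; apply: cvgM => //; exact: cvg_cst.
Qed.

Lemma cvg_pearson {T} (F : set_system T) {FF : Filter F} (f : T -> 'cV[R]_M) y x :
  nonvanishing (H *m x) -> (forall j, f t j 0 @[t --> F] --> x j 0) ->
  pearson H y (f t) @[t --> F] --> pearson H y x.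
Proof.
move=> Hx fx; apply: cvg_big_sum => i; have h := cvg_mulmx_entry F f x i fx.
apply: cvgM; last by apply: cvgV; [exact: Hx|exact: h].
under eq_fun do rewrite expr2; rewrite expr2.
by apply: cvgM; apply: cvgB; first [exact: h|exact: cvg_cst].
Qed.

Lemma data_gap_ge0 y x : cone y -> positive _ (H *m x) -> 0 <= data_gap H y x.
Proof. by move=> y0 Hx; apply: sumr_ge0 => i _; exact: kl_ge0. Qed.

Lemma cone_gap_ge0 z x : 'I_N -> cone z -> positive _ x -> 0 <= cone_gap H z x.
Proof.
move=> i0 z0 x0; apply: sumr_ge0 => j _; rewrite mulr_ge0 ?kl_ge0//.
by rewrite ltW// sensitivity_gt0.
Qed.

Section Trajectory.
Variables (y : 'cV[R]_N) (x0 : 'cV[R]_M) (i0 : 'I_N) (j0 : 'I_M).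
Hypothesis (y_pos : positive _ y) (x0_pos : positive _ x0).
Let x_ := em H x0 y.

Let x_pos k : positive _ (x_ k).
Proof. exact: em_positive. Qed.

Let Hx_pos k : positive _ (H *m x_ k).
Proof. by apply: mulmx_positive => //; [exact: positive_cone|exact: positive_neq0]. Qed.

Let bound := \sum_i y i 0.

(** One term of the conserved mass. The index is k.+1 because the mass of [x0] is unrelated to that
    of [y]. *)
Lemma em_le k j : x_ k.+1 j 0 <= bound / sensitivity H j.
Proof.
have sj := sensitivity_gt0 H H_pos i0 j.
rewrite ler_pdivlMr// /bound -(sum_sensitivity_em_step H H_pos y (x_ k))//.
rewrite (bigD1 j)//= mulrC lerDl sumr_ge0// => l _.
by rewrite mulr_ge0// ltW//; [exact: sensitivity_gt0|exact: (x_pos k.+1)].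
Qed.

Lemma mulmx_em_le k i : (H *m x_ k.+1) i 0 <= bound.
Proof.
rewrite /bound -(sum_sensitivity_em_step H H_pos y (x_ k))// sum_sensitivity.
rewrite (bigD1 i)//= lerDl sumr_ge0// => l _.
by rewrite ltW//; exact: (Hx_pos k.+1).
Qed.

Lemma cone_gap_cvg z : cone z -> H *m z = y -> cvgn (cone_gap H z \o x_).
Proof.
move=> z0 Hz; apply: nonincreasing_is_cvgn.
  apply/nonincreasing_seqP => k /=.
  have := em_step_descent H H_pos y (x_ k) z i0 j0 y_pos (x_pos k) z0 Hz.
  by apply: le_trans; rewrite lerDl data_gap_ge0//; exact: positive_cone.
by exists 0 => _ [k _ <-] /=; exact: cone_gap_ge0.
Qed.

(** By descent the data gap is at most the difference of consecutive terms of the convergent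
    sequence of cone gaps. *)
Lemma data_gap_cvg0 z : cone z -> H *m z = y -> data_gap H y (x_ k) @[k --> \oo] --> 0.
Proof.
move=> z0 Hz; have /cvg_ex[l hl] := cone_gap_cvg z z0 Hz.
apply: (@squeeze_cvgr _ _ _ _ (cst 0)
  (fun k => cone_gap H z (x_ k) - cone_gap H z (x_ k.+1))).
- apply: nearW => k; rewrite data_gap_ge0//=; last exact: positive_cone.
  have := em_step_descent H H_pos y (x_ k) z i0 j0 y_pos (x_pos k) z0 Hz.
  by rewrite lerBrDl.
- exact: cvg_cst.
- rewrite -(subrr l); apply: cvgB => //.
  by rewrite (cvg_shiftS (cone_gap H z \o x_)).
Qed.

Lemma mulmx_em_cvg z i : cone z -> H *m z = y ->
  (H *m x_ k) i 0 @[k --> \oo] --> y i 0.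
Proof.
move=> z0 Hz; apply: (@cvg_of_kl0 _ _ _ _ _ bound); first exact: ltW.
  by apply: near_inftyS; apply: nearW => k; rewrite mulmx_em_le andbT; exact: (Hx_pos k.+1).
apply: (@squeeze_cvgr _ _ _ _ (cst 0) (fun k => data_gap H y (x_ k))).
- have kl0 k l : 0 <= kl (y l 0) ((H *m x_ k) l 0).
    by apply: kl_ge0; [exact: ltW|exact: Hx_pos].
  by apply: nearW => k; rewrite kl0/= /data_gap (bigD1 i)//= lerDl sumr_ge0.
- exact: cvg_cst.
- exact: data_gap_cvg0 z0 Hz.
Qed.

Lemma em_cvg z : cone z -> H *m z = y ->
  exists2 xhat, cone xhat /\ H *m xhat = y &
    forall j, x_ k j 0 @[k --> \oo] --> xhat j 0.
Proof.
move=> z0 Hz; have s0 := sensitivity_gt0 H H_pos i0.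
have FP : ProperFilter ((x_ k)^T @[k --> \oo]) by exact: fmap_proper_filter.
(* An ultrafilter finer than the tail filter of the iterates plays the role of
   a convergent subsequence. *)
have [G [GU FG]] := ultraFilterLemma FP.
pose box j := `[0, bound / sensitivity H j]%classic.
have : compact [set v : 'rV[R]_M | forall j, box j (v ord0 j)].
  by apply: (@rV_compact R M box) => j; exact: segment_compact.
rewrite compact_ultra => /(_ G GU)[|p [Kp Gp]].
  apply: FG; apply: near_inftyS; apply: nearW => k /= j.
  by rewrite /box/= in_itv/= mxE em_le andbT ltW//; exact: (x_pos k.+1).
have GP : ProperFilter G by exact: ultra_proper.
have Gv j : (v : 'rV[R]_M)^T j 0 @[v --> G] --> p^T j 0.
  rewrite mxE (_ : (fun v : 'rV[R]_M => v^T j 0) = (fun v => v ord0 j)).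
    exact: cvg_entry.
  by apply/funext => v; rewrite mxE.
(* [G] refines the tail filter, so it inherits every limit along the iterates; uniqueness of limits
   then allows such a limit to be computed at the cluster point. *)
have lim_em (f : 'cV[R]_M -> R) (a b : R) : f (x_ k) @[k --> \oo] --> a ->
    f v^T @[v --> G] --> b -> a = b.
  move=> fa fb; have fa' : f v^T @[v --> G] --> a.
    move=> A /fa fA; apply: FG.
    by apply: (filterS (F := \oo) _ fA) => k /=; rewrite trmxK.
  by rewrite -(cvg_lim (@Rhausdorff R) fa') (cvg_lim (@Rhausdorff R) fb).
have cp : cone p^T by move=> j; rewrite mxE; have := Kp j; rewrite /box/= in_itv => /andP[].
have Hp : H *m p^T = y.
  apply/matrixP => i l; rewrite ord1; apply/esym.
  apply: (lim_em (fun x => (H *m x) i 0) _ _ (mulmx_em_cvg z i z0 Hz)).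
  exact: cvg_mulmx_entry.
(* Since H p^T = y, the cluster point itself may serve as the reference point of the descent. The
   gap to it converges along k, and its limit is found along [G]. *)
have gap0 : cone_gap H p^T (x_ k) @[k --> \oo] --> 0.
  have /cvg_ex[l hl] := cone_gap_cvg p^T cp Hp.
  suff : l = 0 by move=> <-.
  apply: (lim_em (cone_gap H p^T)) => //.
  rewrite -[X in _ --> X](_ : \sum_(j < M) 0 = 0); last by rewrite big1.
  apply: cvg_big_sum => j; rewrite -(mulr0 (sensitivity H j)).
  apply: cvgM; first exact: cvg_cst.
  apply: cvg_kl0; first exact: cp.
    by apply: FG; apply: (@filterE _ \oo) => k /=; rewrite trmxK; exact: x_pos.
  exact: Gv.
exists p^T => // j; apply: (@cvg_of_kl0 _ _ _ _ _ (bound / sensitivity H j)).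
- exact: cp.
- by apply: near_inftyS; apply: nearW => k; rewrite em_le andbT; exact: (x_pos k.+1).
- have h : (sensitivity H j)^-1 * cone_gap H p^T (x_ k) @[k --> \oo] --> 0.
    by rewrite -(mulr0 (sensitivity H j)^-1); apply: cvgM => //; exact: cvg_cst.
  apply: squeeze_cvgr _ (cvg_cst 0) h; apply: nearW => k.
  rewrite kl_ge0 ?x_pos//= ?cp// ler_pdivlMl//.
  rewrite /cone_gap (bigD1 j)//= lerDl sumr_ge0// => l _.
  by rewrite mulr_ge0 ?kl_ge0 ?x_pos ?cp// ltW.
Qed.

End Trajectory.
End EMConvergence.

(** * Pearson's statistic, exact solutions, and necessity of y in H(C) *)

Section Pearson.
Context {R : realType} {N M : nat} (H : 'M[R]_(N, M)).
Hypothesis H_pos : forall i j, 0 < H i j.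
Implicit Types (x z : 'cV[R]_M) (y : 'cV[R]_N).

Lemma pearson_term_le y x i : positive _ (H *m x) ->
  ((H *m x) i 0 - y i 0) ^+ 2 / (H *m x) i 0 <= pearson H y x.
Proof.
move=> Hx; rewrite /pearson (bigD1 i)//= lerDl sumr_ge0// => l _.
by rewrite divr_ge0 ?sqr_ge0// ltW.
Qed.

Lemma pearson_ge0 y x : positive _ (H *m x) -> 0 <= pearson H y x.
Proof. by move=> Hx; rewrite sumr_ge0// => l _; rewrite divr_ge0 ?sqr_ge0// ltW. Qed.

Lemma pearson_eq0 y x : positive _ (H *m x) -> pearson H y x = 0 -> H *m x = y.
Proof.
move=> Hx p0; apply/matrixP => i j; rewrite ord1; apply/eqP.
have := pearson_term_le y x i Hx; rewrite p0 ler_pdivrMr// mul0r.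
by rewrite real_exprn_even_le0 ?num_real//= subr_eq0.
Qed.

Lemma pearson_data x : pearson H (H *m x) x = 0.
Proof.
by rewrite /pearson big1// => i _; rewrite subrr expr0n mul0r.
Qed.

Lemma KL_ge0 y x : cone y -> cone x -> (0 <= KL H y x)%E.
Proof.
move=> y0 x0; apply: sume_ge0 => i _; rewrite /log_term.
have := mulmx_ge0 H H_pos x x0 i; move: ((H *m x) i 0) => t t0.
have [->|s0] := eqVneq; first by rewrite add0e subr0 lee_fin.
have [->|tn0] := eqVneq; first by rewrite addye.
rewrite -EFinD lee_fin addrA; apply: kl_ge0; first exact: y0.
by rewrite lt_def tn0.
Qed.

Lemma KL_data x : cone x -> KL H (H *m x) x = 0%E.
Proof.
move=> x0; rewrite /KL big1// => i _; rewrite /log_term subrr adde0.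
by have [//|s0] := eqVneq; rewrite divff// ln1 mulr0.
Qed.

Lemma ml_solution_data x : cone x -> ml_solution H (H *m x) x.
Proof.
by move=> x0; split => // z z0; rewrite KL_data// KL_ge0//; exact: mulmx_ge0.
Qed.

(** For necessity [y] may have zero entries, so iterates are only known to stay in the cone;
    division by 0 yields 0 and preserves signs. *)
Lemma em_cone x0 y k : cone y -> cone x0 -> cone (em H x0 y k).
Proof.
move=> y0 x00; elim: k => //= k IH j; rewrite em_stepE.
rewrite mulr_ge0// mulr_ge0 ?invr_ge0 ?sumr_ge0// => i _; first exact: ltW.
rewrite mulr_ge0 ?divr_ge0//; [exact: ltW|exact: mulmx_ge0].
Qed.

(** Each term of the test gives ((H z_L)_i - y_i)^2 <= (tau N / L) (H z_L)_i. In this multiplied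
    form it passes to the limit even if (H xhat)_i = 0. *)
Lemma em_pearson_converse y x0 tau : cone y -> cone x0 ->
  regularization_method H y (em_pearson H x0 tau) ->
  exists2 x, cone x & H *m x = y.
Proof.
move=> y0 x00 [_ [k [stop [xhat [[xhat0 _] lim]]]]].
(* Rescaling whichever iterate was selected treats all k(L) alike, including k(L) = 0. *)
pose z L : 'cV[R]_M := L^-1 *: em H x0 (L *: y) (k L).
have {}lim j : z L j 0 @[L --> +oo%R] --> xhat j 0 by apply: cvg_entry.
exists xhat => //; apply/matrixP => i l; rewrite ord1; apply/eqP.
have Hlim := cvg_mulmx_entry H _ z xhat i lim.
have Vlim : L^-1 @[L --> +oo%R] --> (0 : R).
  by apply/gtr0_cvgV0; [exact: nbhs_pinfty_gt|exact: cvg_id].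
suff : ((H *m xhat) i 0 - y i 0) ^+ 2 <= tau * N%:R * 0 * (H *m xhat) i 0.
  by rewrite mulr0 mul0r real_exprn_even_le0 ?num_real//= subr_eq0.
have : tau * N%:R * L^-1 * (H *m z L) i 0 @[L --> +oo%R] -->
    tau * N%:R * 0 * (H *m xhat) i 0.
  apply: cvgM; last exact: Hlim.
  by apply: cvgM; [exact: cvg_cst|exact: Vlim].
have : ((H *m z L) i 0 - y i 0) ^+ 2 @[L --> +oo%R] -->
    ((H *m xhat) i 0 - y i 0) ^+ 2.
  rewrite expr2; under eq_fun do rewrite expr2.
  by apply: cvgM; apply: cvgB; first [exact: Hlim|exact: cvg_cst].
move=> h1 h2; apply: (ler_cvg_to h1 h2).
near=> L; have L0 : 0 < L by near: L; apply: nbhs_pinfty_gt; exact: num_real.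
have [[_ [Hn pt]] _] := stop L L0.
have ez : em H x0 (L *: y) (k L) = L *: z L by rewrite scalerA divff ?gt_eqF// scale1r.
move: Hn pt; rewrite /= ez pearsonZ// => Hn pt.
have Hz : positive _ (H *m z L).
  move=> i'; have := Hn i'; rewrite -scalemxAr mxE mulf_eq0 gt_eqF//= => Hz0.
  rewrite lt_def Hz0; apply: mulmx_ge0 => //= j; rewrite mxE mulr_ge0 ?invr_ge0 ?(ltW L0)//.
  by apply: em_cone => // i''; rewrite mxE mulr_ge0// ltW.
rewrite -ler_pdivrMr// (le_trans (pearson_term_le y (z L) i Hz))//.
by rewrite ler_pdivlMr// mulrC.
Unshelve. all: by end_near. Qed.

End Pearson.

(** * Attained data: EM stops, and the rescaled stopped iterates converge *)

Section Sufficiency.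
Context {R : realType} {N M : nat} (H : 'M[R]_(N, M)).
Hypothesis H_pos : forall i j, 0 < H i j.
Variables (tau : R) (x0 : 'cV[R]_M) (i0 : 'I_N).
Hypothesis (x0_pos : positive _ x0) (tau_gt0 : 0 < tau).

Lemma em_defined_positive y k : positive _ y -> 'I_M -> em_defined H x0 y k.
Proof.
move=> y0 j0 l _; split => [j|i]; rewrite gt_eqF//.
  by rewrite trmx_onesE; exact: sensitivity_gt0.
by apply: mulmx_positive => //; [apply: positive_cone|apply: (positive_neq0 _ _ j0)];
  exact: em_positive.
Qed.

Variable y : 'cV[R]_N.
Hypothesis (y_pos : positive _ y) (j0 : 'I_M).
Let x_ := em H x0 y.
Let A := em_pearson H x0 tau.

Let Hx_pos k : positive _ (H *m x_ k).
Proof.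
by apply: mulmx_positive => //; [apply: positive_cone|apply: (positive_neq0 _ _ j0)];
  exact: em_positive.
Qed.

(** Moves the tests for all data L y to the single trajectory [x_]; only successor indices scale
    with L. *)
Lemma stops_atS L k : 0 < L ->
  stops_at A (L *: y) k.+1 <-> L * pearson H y (x_ k.+1) <= tau * N%:R.
Proof.
move=> L0; have Ly : positive _ (L *: y) by move=> i; rewrite mxE mulr_gt0.
rewrite -pearsonZ// -em_scale_data ?gt_eqF//; split=> [[_ []]//|h].
split; first exact: em_defined_positive.
split => // i; rewrite -[iterate _ _ _]/(em H x0 (L *: y) k.+1).
by rewrite em_scale_data ?(lt0r_neq0 L0)// -scalemxAr mxE gt_eqF// mulr_gt0//; exact: (Hx_pos k.+1).
Qed.

(** As [x0] stays fixed, its term (h - L y)^2 / h at [i0] grows like L^2 and exceeds tau N. *)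
Lemma not_stops_at0 : \forall L \near +oo%R, ~ stops_at A (L *: y) 0.
Proof.
have h0 := Hx_pos 0 i0.
near=> L => -[_ [_ /=]]; apply/negP; rewrite -ltNge.
apply: lt_le_trans (pearson_term_le H (L *: y) x0 i0 (Hx_pos 0)).
set h := (H *m x_ 0) i0 0 in h0 *; set t := tau * N%:R.
rewrite -/h ltr_pdivlMr// mxE -sqrrN opprB.
have t0 : 0 <= t * h by rewrite !mulr_ge0// ltW.
(* With u = L y - h this threshold gives u > 1 + t h, hence u >= 1 and u^2 >= u > t h. *)
have : (h + 1 + t * h) / y i0 0 < L by near: L; apply: nbhs_pinfty_gt; exact: num_real.
rewrite ltr_pdivrMr// -addrA -ltrBrDl.
set u := _ - h => hu; apply: (@lt_le_trans _ _ u); first lra.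
by rewrite expr2 ler_peMr//; lra.
Unshelve. all: by end_near. Qed.

Lemma em_stationary k l : H *m x_ k = y -> (k <= l)%N -> x_ l = x_ k.
Proof.
move=> Hx /subnK <-; rewrite /x_ /em iterD -/(em H x0 y k).
by elim: (l - k)%N => //= n ->; apply: em_step_fixed.
Qed.

Lemma em_pearson_regularization x : cone x -> H *m x = y ->
  regularization_method H y A.
Proof.
move=> x_ge0 Hx; split.
  move=> x' x'0 x'n0 k; have := x'n0 => /cv_neq0P[j _].
  by apply: em_defined_positive => //; exact: mulmx_positive.
have [xhat [xhat0 Hxhat] lim] := em_cvg H H_pos y x0 i0 j0 y_pos x0_pos x x_ge0 Hx.
have N0 : 0 < tau * N%:R by rewrite mulr_gt0// ltr0n (leq_trans _ (ltn_ord i0)).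
have p0 : pearson H y (x_ k) @[k --> \oo] --> 0.
  rewrite -(pearson_data H xhat) Hxhat; apply: cvg_pearson => // i.
  by rewrite Hxhat gt_eqF.
(* The condition on L sits under the existential so that [choice] gives a total function; 0 is a
   dummy value for L <= 0. *)
have kex L : exists k, 0 < L -> first_stop A (L *: y) k.
  have [L0|] := ltP 0 L; last by exists 0%N.
  have : exists k, `[< stops_at A (L *: y) k >].
    have : \forall k \near \oo, pearson H y (x_ k.+1) < tau * N%:R / L.
      apply: (cvgr_lt _ _ (tau * N%:R / L) (divr_gt0 N0 L0)).
      by rewrite (cvg_shiftS (fun k => pearson H y (x_ k))).
    move=> [k _ /(_ k (leqnn k))]; rewrite ltr_pdivlMr// mulrC => /ltW h.
    by exists k.+1; apply/asboolP/stops_atS.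
  case/ex_minnP => k /asboolP hk kmin; exists k => _; split => // l lk /asboolP hl.
  by have := kmin l hl; rewrite leqNgt lk.
have [k stop] := choice kex; exists k; split; first exact: stop.
exists xhat; split; first by rewrite -Hxhat; apply: ml_solution_data.
apply: cvg_entries => j l; rewrite ord1 => B /lim[K _ KB].
(* From [K] on the iterates are already in [B]. Below it there are finitely many indices, so one
   threshold on L serves them all. *)
have : \forall L \near +oo%R, forall m : 'I_K,
    pearson H y (x_ m) = 0 \/ tau * N%:R < L * pearson H y (x_ m).
  apply: filter_forall => m; have [->|pn0] := eqVneq (pearson H y (x_ m)) 0.
    by apply: nearW; left.
  have pm : 0 < pearson H y (x_ m) by rewrite lt_def pn0 pearson_ge0.
  near=> L; right; rewrite -ltr_pdivrMr//; near: L; apply: nbhs_pinfty_gt; exact: num_real.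
move=> hK; change (\forall L \near +oo%R, B ((L^-1 *: em H x0 (L *: y) (k L)) j 0)).
near=> L.
have L0 : 0 < L by near: L; apply: nbhs_pinfty_gt; exact: num_real.
have [st _] := stop L L0.
have : k L <> 0%N.
  move=> kL; move: st; rewrite kL; near: L; exact: not_stops_at0.
case kLE : (k L) => [//|m] _; rewrite em_scale_data ?gt_eqF//.
rewrite scalerA mulVf ?gt_eqF// scale1r -/(x_ m.+1).
have [Km|mK] := leqP K m.+1; first exact: KB.
move: st; rewrite kLE => /(stops_atS L m L0) pm.
have /(_ (Ordinal mK))/= : forall m : 'I_K,
    pearson H y (x_ m) = 0 \/ tau * N%:R < L * pearson H y (x_ m) by near: L.
(* Stopping before [K] is possible only at an exact solution, which is a fixed point and thus equals
   the [K]-th iterate. *)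
case=> [/pearson_eq0 Hm|]; last by rewrite ltNge pm.
have xK := em_stationary m.+1 K (Hm (Hx_pos m.+1)) (ltnW mK).
by have : B (x_ K j 0) := KB K (leqnn K); rewrite xK.
Unshelve. all: by end_near. Qed.

End Sufficiency.

Theorem theorem3p3 (R : realType) (N M : nat) (H : 'M[R]_(N, M))
    (y : 'cV[R]_N) (tau : R) (x0 : 'cV[R]_M)
    (H_pos : forall i j, 0 < H i j)
    (y_ge0 : forall i, 0 <= y i 0) (y_neq0 : y != 0)
    (tau_gt0 : 0 < tau)
    (x0_pos : forall j, 0 < x0 j 0) :
  regularization_method H y (em_pearson H x0 tau) <->
  ([set H *m x | x in @cone R M] : set 'cV[R]_N) y.
Proof.
split.
  by apply: em_pearson_converse => //; exact: positive_cone.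
move=> [x x_ge0 Hx].
(* A nonzero x makes every entry of y = H x strictly positive, and the nonzero vectors supply
   inhabitants of both index types. *)
have xn0 : x != 0 by apply: contra_neq y_neq0 => x0E; rewrite -Hx x0E mulmx0.
have [i0 _] := cv_neq0P _ _ y_neq0; have [j0 _] := cv_neq0P _ _ xn0.
apply: (em_pearson_regularization H H_pos _ _ i0 _ _ _ _ j0 _ x_ge0 Hx) => //.
by rewrite -Hx; exact: mulmx_positive.
Qed.
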